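(* For every closed term $M\in\Lambda_\oplus$, $\mathcal{B}_{\mathsf{CV}}(M)=\mathcal{S}_{\mathsf{IV}}(M)$; that is, the coinductive call-by-value big-step semantics and the inductive call-by-value small-step semantics of $M$ are the same distribution.
   Context: Terms. $\Lambda_\oplus$ is the set of terms $M ::= x \mid \lambda x.M \mid MN \mid M\oplus N$, with $x$ ranging over a denumerable set of variables, modulo renaming of bound variables; a term is closed if it has no free variables; $M[x:=N]$ is capture-avoiding substitution. A value is a variable or an abstraction; $\mathsf{Val}$ is the set of values, ranged over by $V,W$. Distributions. A distribution is a function $\mathscr{D}:\mathsf{Val}\to[0,1]$ with $\sum_{V}\mathscr{D}(V)\le 1$. Its support is $\mathsf{S}(\mathscr{D})=\{V\mid \mathscr{D}(V)>0\}$ and its sum is $\sum\mathscr{D}=\sum_V\mathscr{D}(V)$. $\emptyset$ is the zero distribution and $\{V^1\}$ gives probability $1$ to $V$. Order, sums, scalar multiples, $\sup$ and $\inf$ of distributions are pointwise. Call-by-value reduction. $\mapsto_{\mathsf v}$ is the least relation between terms and finite sequences of terms such that: $(\lambda x.M)V\mapsto_{\mathsf v} M[x:=V]$; $V\oplus W\mapsto_{\mathsf v} V,W$; and, if $M\mapsto_{\mathsf v} L_1,\dots,L_n$, then $MN\mapsto_{\mathsf v} L_1N,\dots,L_nN$, $VM\mapsto_{\mathsf v} VL_1,\dots,VL_n$, $M\oplus N\mapsto_{\mathsf v} L_1\oplus N,\dots,L_n\oplus N$, and $V\oplus M\mapsto_{\mathsf v} V\oplus L_1,\dots,V\oplus L_n$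 ($V,W$ values). Small-step semantics. $M\Rightarrow_{\mathsf{IV}}\mathscr{D}$ is defined inductively by: $M\Rightarrow_{\mathsf{IV}}\emptyset$ for every $M$; $V\Rightarrow_{\mathsf{IV}}\{V^1\}$ for every value $V$; if $M\mapsto_{\mathsf v} N_1,\dots,N_n$ and $N_i\Rightarrow_{\mathsf{IV}}\mathscr{D}_i$ for all $i$, then $M\Rightarrow_{\mathsf{IV}}\sum_{i=1}^n\frac1n\mathscr{D}_i$. $\mathcal{S}_{\mathsf{IV}}(M)=\sup\{\mathscr{D}\mid M\Rightarrow_{\mathsf{IV}}\mathscr{D}\}$. Big-step semantics. $M\Downarrow_{\mathsf{CV}}\mathscr{D}$ is the coinductive interpretation (the largest set of judgments each of which is the conclusion of a rule instance all of whose premises belong to the set) of the rules: (value) $V\Downarrow_{\mathsf{CV}}\{V^1\}$, no premises; (application) from $M\Downarrow_{\mathsf{CV}}\mathscr{D}$, $N\Downarrow_{\mathsf{CV}}\mathscr{E}$ and $P[x:=V]\Downarrow_{\mathsf{CV}}\mathscr{F}_{P,V}$ for all $\lambda x.P\in\mathsf{S}(\mathscr{D})$, $V\in\mathsf{S}(\mathscr{E})$, infer $MN\Downarrow_{\mathsf{CV}}\sum_{\lambda x.P\in\mathsf{S}(\mathscr{D}),V\in\mathsf{S}(\mathscr{E})}\mathscr{D}(\lambda x.P)\cdot\mathscr{E}(V)\cdot\mathscr{F}_{P,V}$; (choice) from $M\Downarrow_{\mathsf{CV}}\mathscr{D}$ and $N\Downarrow_{\mathsf{CV}}\mathscr{E}$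 infer $M\oplus N\Downarrow_{\mathsf{CV}}\frac12\mathscr{D}\cdot(\sum\mathscr{E})+\frac12\mathscr{E}\cdot(\sum\mathscr{D})$. $\mathcal{B}_{\mathsf{CV}}(M)=\inf\{\mathscr{D}\mid M\Downarrow_{\mathsf{CV}}\mathscr{D}\}$. *)

(* Defs.v *)
From HB Require Import structures.
From mathcomp Require Import all_boot all_order all_algebra.
From mathcomp Require Import all_classical all_reals all_analysis.
Set Implicit Arguments.
Unset Strict Implicit.
Unset Printing Implicit Defensive.
Import Order.TTheory GRing.Theory Num.Theory.

Local Open Scope classical_set_scope.
Local Open Scope ring_scope.
Local Open Scope ereal_scope.

(* De Bruijn representation of terms modulo renaming of bound variables:
   [Lam] binds index 0, and the indices that escape all the enclosing
   abstractions are the free variables. *)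
Inductive term : Type :=
| Var of nat
| Lam of term
| App of term & term
| Oplus of term & term.

Fixpoint term_encode (M : term) : GenTree.tree nat :=
  match M with
  | Var n => GenTree.Leaf n
  | Lam P => GenTree.Node 0 [:: term_encode P]
  | App M1 M2 => GenTree.Node 1 [:: term_encode M1; term_encode M2]
  | Oplus M1 M2 => GenTree.Node 2 [:: term_encode M1; term_encode M2]
  end.

Fixpoint term_decode (t : GenTree.tree nat) : option term :=
  match t with
  | GenTree.Leaf n => Some (Var n)
  | GenTree.Node 0 [:: t1] => omap Lam (term_decode t1)
  | GenTree.Node 1 [:: t1; t2] =>
      obind (fun M1 => omap (App M1) (term_decode t2)) (term_decode t1)
  | GenTree.Node 2 [:: t1; t2] =>
      obind (fun M1 => omap (Oplus M1) (term_decode t2)) (term_decode t1)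
  | _ => None
  end.

Lemma term_encodeK : pcancel term_encode term_decode.
Proof.
by elim=> [n|P IH|M1 IH1 M2 IH2|M1 IH1 M2 IH2] //=; rewrite ?IH ?IH1 ?IH2.
Qed.

HB.instance Definition _ := Countable.copy term (pcan_type term_encodeK).

Fixpoint is_free (k : nat) (M : term) : bool :=
  match M with
  | Var n => n == k
  | Lam P => is_free k.+1 P
  | App M1 M2 | Oplus M1 M2 => is_free k M1 || is_free k M2
  end.

Definition closed_term (M : term) : Prop := forall k : nat, ~~ is_free k M.

Definition up_ren (r : nat -> nat) (n : nat) : nat :=
  if n is m.+1 then (r m).+1 else 0%N.

Fixpoint rename (r : nat -> nat) (M : term) : term :=
  match M with
  | Var n => Var (r n)
  | Lam P => Lam (rename (up_ren r) P)
  | App M1 M2 => App (rename r M1) (rename r M2)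
  | Oplus M1 M2 => Oplus (rename r M1) (rename r M2)
  end.

Definition up_subst (s : nat -> term) (n : nat) : term :=
  if n is m.+1 then rename succn (s m) else Var 0.

Fixpoint psubst (s : nat -> term) (M : term) : term :=
  match M with
  | Var n => s n
  | Lam P => Lam (psubst (up_subst s) P)
  | App M1 M2 => App (psubst s M1) (psubst s M2)
  | Oplus M1 M2 => Oplus (psubst s M1) (psubst s M2)
  end.

(* [subst0 P N] is P[x := N] for the variable x bound in [Lam P]: index 0 is
   replaced by N and the other free variables of P are shifted down. *)
Definition subst0 (P N : term) : term :=
  psubst (fun n => if n is m.+1 then Var m else N) P.

Definition is_value (M : term) : bool :=
  match M with
  | Var _ | Lam _ => true
  | App _ _ | Oplus _ _ => false
  end.

Record value : Type := Value { value_term :> term; _ : is_value value_term }.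

HB.instance Definition _ := [isSub for value_term].
HB.instance Definition _ := [Countable of value by <:].

Definition vlam (P : term) : value := @Value (Lam P) isT.

Lemma vlam_inj : injective vlam.
Proof. by move=> P Q [->]. Qed.

Lemma esum_mull_le (R : realType) (T : choiceType) (I : set T) (c : \bar R)
    (f : T -> \bar R) : 0 <= c -> (forall i, 0 <= f i) ->
  \esum_(i in I) (c * f i) <= c * \esum_(i in I) f i.
Proof.
move=> c0 f0; apply: ge_ereal_sup => /= _ [X finX <-].
by rewrite -ge0_mule_fsumr// lee_wpmul2l// ereal_sup_ubound//; exists X.
Qed.

Lemma exchange_esum (R : realType) (T1 T2 : choiceType) (I : set T1)
    (J : set T2) (f : T1 -> T2 -> \bar R) : (forall i j, 0 <= f i j) ->
  \esum_(i in I) \esum_(j in J) f i j = \esum_(j in J) \esum_(i in I) f i j.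
Proof.
move=> f0; rewrite !esum_esum//.
rewrite (reindex_esum (J `*` I) _ (fun k => (k.2, k.1)))//; split=> //=.
- by move=> [j i] [/= ? ?].
- by move=> [j i] [j' i'] _ _ [-> ->].
- by move=> [i j] [/= ? ?]; exists (j, i).
Qed.

Lemma esum_subset (R : realType) (T : choiceType) (I J : set T)
    (f : T -> \bar R) : I `<=` J ->
  \esum_(i in I) f i <= \esum_(i in J) f i.
Proof.
move=> IJ; apply: ge_ereal_sup => /= _ [X [finX XI] <-].
by apply: ereal_sup_ubound; exists X => //; split=> //; exact: subset_trans IJ.
Qed.

Section Distributions.
Variable R : realType.

Definition is_distr (D : value -> \bar R) : Prop :=
  (forall V, 0 <= D V <= 1) /\ \esum_(V in [set: value]) D V <= 1.

Record distr : Type :=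
  Distr { distr_fun :> value -> \bar R; distrP : is_distr distr_fun }.

Definition distr_support (D : distr) : set value := [set V | 0 < D V].

Definition mass (D : distr) : \bar R := \esum_(V in [set: value]) D V.

Lemma distr_ge0 (D : distr) V : 0 <= D V.
Proof. by case: D => D /= [D01 _]; have /andP[] := D01 V. Qed.

Lemma mass_ge0 (D : distr) : 0 <= mass D.
Proof. by apply: esum_ge0 => V _; exact: distr_ge0. Qed.

Lemma mass_le1 (D : distr) : mass D <= 1.
Proof. by case: D => D /= []. Qed.

Lemma is_distr_mass (D : value -> \bar R) : (forall V, 0 <= D V) ->
  \esum_(V in [set: value]) D V <= 1 -> is_distr D.
Proof.
move=> D0 D1; split=> // V; rewrite D0/=; apply: le_trans D1.
by rewrite -(esum_set1 (D0 V)); exact: esum_subset.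
Qed.

Lemma distr0_subproof : is_distr (fun=> 0).
Proof. by apply: is_distr_mass => //; rewrite esum1. Qed.

Definition distr0 : distr := Distr distr0_subproof.

Lemma dirac_value_subproof (V : value) :
  is_distr (fun W => (W == V)%:R%:E).
Proof.
apply: is_distr_mass => [W|]; first by rewrite lee_fin.
rewrite (esumID [set V])//.
rewrite setTI setTI esum_set1 ?eqxx ?lee_fin// esum1 ?adde0//.
by move=> W /= /eqP/negbTE ->.
Qed.

Definition dirac_value (V : value) : distr := Distr (dirac_value_subproof V).

Lemma distr_avg_subproof (n : nat) (D : 'I_n -> distr) :
  is_distr (fun V => \sum_(i < n) (n%:R^-1)%:E * D i V).
Proof.
have c0 : 0 <= (n%:R^-1)%:E :> \bar R by rewrite lee_fin.
have cD0 i V : 0 <= (n%:R^-1)%:E * D i V by rewrite mule_ge0 ?distr_ge0.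
apply: is_distr_mass => [V|]; first by rewrite sume_ge0.
rewrite esum_sum//.
apply: (@le_trans _ _ (\sum_(i < n) (n%:R^-1)%:E)); last first.
  rewrite sumEFin sumr_const card_ord lee_fin -[leLHS]mulr_natr.
  case: n {D cD0 c0} => [|n]; first by rewrite mulr0 ler01.
  by rewrite mulVf ?pnatr_eq0.
apply: lee_sum => i _.
apply: le_trans (esum_mull_le _ c0 (@distr_ge0 (D i))) _.
by rewrite -[leRHS]mule1 lee_wpmul2l// mass_le1.
Qed.

Definition distr_avg (n : nat) (D : 'I_n -> distr) : distr :=
  Distr (distr_avg_subproof D).

Lemma distr_app_subproof (D E : distr) (F : term -> value -> distr) :
  is_distr (fun W => \esum_(k in [set k : term * value |
                                   distr_support D (vlam k.1) /\ distr_support E k.2])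
                       (D (vlam k.1) * E k.2 * F k.1 k.2 W)).
Proof.
have DE0 (k : term * value) : 0 <= D (vlam k.1) * E k.2.
  by rewrite mule_ge0 ?distr_ge0.
have DEF0 (k : term * value) W : 0 <= D (vlam k.1) * E k.2 * F k.1 k.2 W.
  by rewrite mule_ge0 ?distr_ge0.
apply: is_distr_mass => [W|]; first exact: esum_ge0.
rewrite exchange_esum//.
apply: (@le_trans _ _ (\esum_(k in [set: term] `*` [set: value])
    (D (vlam k.1) * E k.2))); last first.
  rewrite -(@esum_esum _ _ _ setT (fun=> setT)
    (fun P V => D (vlam P) * E V)); last by move=> P V _ _; exact: DE0 (P, V).
  apply: (@le_trans _ _ (\esum_(P in [set: term]) D (vlam P))).
    apply: le_esum => P _.
    apply: le_trans (esum_mull_le _ (distr_ge0 _ _) (@distr_ge0 E)) _.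
    by rewrite -[leRHS]mule1 lee_wpmul2l ?distr_ge0// mass_le1.
  rewrite -(@esum_image _ _ _ [set: term] vlam D); last first.
    by move=> P Q _ _; exact: vlam_inj.
  by apply: le_trans (mass_le1 D); exact: esum_subset.
apply: (@le_trans _ _ (\esum_(k in [set k : term * value |
    distr_support D (vlam k.1) /\ distr_support E k.2]) (D (vlam k.1) * E k.2))); last first.
  exact: esum_subset.
apply: le_esum => k _.
apply: le_trans (esum_mull_le _ (DE0 k) (@distr_ge0 (F k.1 k.2))) _.
by rewrite -[leRHS]mule1 lee_wpmul2l// mass_le1.
Qed.

Definition distr_app (D E : distr) (F : term -> value -> distr) : distr :=
  Distr (distr_app_subproof D E F).

Lemma distr_choice_subproof (D E : distr) :
  is_distr (fun V => (2^-1)%:E * (D V * mass E) + (2^-1)%:E * (E V * mass D)).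
Proof.
have h0 : 0 <= (2^-1)%:E :> \bar R by rewrite lee_fin.
have p0 (A B : distr) V : 0 <= A V * mass B.
  by rewrite mule_ge0 ?distr_ge0 ?mass_ge0.
have le_half (A B : distr) :
    \esum_(V in [set: value]) ((2^-1)%:E * (A V * mass B)) <= (2^-1)%:E.
  apply: le_trans (esum_mull_le _ h0 (p0 A B)) _.
  rewrite -[leRHS]mule1 lee_wpmul2l//; apply: le_trans (mass_le1 A).
  apply: le_esum => V _.
  by rewrite -[leRHS]mule1 lee_wpmul2l ?distr_ge0// mass_le1.
apply: is_distr_mass => [V|]; first by rewrite adde_ge0// mule_ge0.
rewrite esumD//; [|by move=> V _; rewrite mule_ge0..].
apply: le_trans (leeD (le_half D E) (le_half E D)) _.
by rewrite -EFinD lee_fin [leRHS]splitr div1r.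
Qed.

Definition distr_choice (D E : distr) : distr :=
  Distr (distr_choice_subproof D E).

Definition distr_sup (A : set distr) (V : value) : \bar R :=
  ereal_sup [set D V | D in A].

(* The infimum is taken in the extended reals, so that that of the empty set
   is +oo, which is not the value of a distribution. *)
Definition distr_inf (A : set distr) (V : value) : \bar R :=
  ereal_inf [set D V | D in A].

End Distributions.

Inductive cbv_red : term -> seq term -> Prop :=
| red_beta (P : term) (V : value) :
    cbv_red (App (Lam P) V) [:: subst0 P V]
| red_choice (V W : value) :
    cbv_red (Oplus V W) [:: (V : term); (W : term)]
| red_appl (M N : term) (Ls : seq term) :
    cbv_red M Ls -> cbv_red (App M N) [seq App L N | L <- Ls]
| red_appr (V : value) (M : term) (Ls : seq term) :
    cbv_red M Ls -> cbv_red (App V M) [seq App V L | L <- Ls]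
| red_choicel (M N : term) (Ls : seq term) :
    cbv_red M Ls -> cbv_red (Oplus M N) [seq Oplus L N | L <- Ls]
| red_choicer (V : value) (M : term) (Ls : seq term) :
    cbv_red M Ls -> cbv_red (Oplus V M) [seq Oplus V L | L <- Ls].

Inductive small_step (R : realType) : term -> distr R -> Prop :=
| small_empty (M : term) : small_step M (distr0 R)
| small_value (V : value) : small_step V (dirac_value R V)
| small_red (M : term) (Ns : seq term) (Ds : 'I_(size Ns) -> distr R) :
    cbv_red M Ns ->
    (forall i : 'I_(size Ns), small_step (tnth (in_tuple Ns) i) (Ds i)) ->
    small_step M (distr_avg Ds).

(* In the application rule only the values of [F] on the supports matter:
   [distr_app] ignores the others. *)
CoInductive big_step (R : realType) : term -> distr R -> Prop :=
| big_value (V : value) : big_step V (dirac_value R V)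
| big_app (M N : term) (D E : distr R) (F : term -> value -> distr R) :
    big_step M D -> big_step N E ->
    (forall (P : term) (V : value), distr_support D (vlam P) -> distr_support E V ->
       big_step (subst0 P V) (F P V)) ->
    big_step (App M N) (distr_app D E F)
| big_choice (M N : term) (D E : distr R) :
    big_step M D -> big_step N E ->
    big_step (Oplus M N) (distr_choice D E).

Definition S_IV (R : realType) (M : term) : value -> \bar R :=
  distr_sup [set D : distr R | small_step M D].

Definition B_CV (R : realType) (M : term) : value -> \bar R :=
  distr_inf [set D : distr R | big_step M D].

(* Main.v *)
(* Both rules for compound terms have the shape "M op N evaluates to the sum of
   D(U) E(V) G(U,V) over the values U, V of M and N", where G(U,V) is the
   semantics of the term U op V.  Let approx n M be the distribution given by n
   levels of the small-step semantics.  Following the left-to-right evaluation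
   order, approx n (M op N) is below this sum for approx n, and the sum with
   fuels m, n and p is below approx (m + n + p) (M op N).  By monotone
   convergence the limit of approx, which is the small-step semantics, satisfies
   the big-step equations exactly, so by coinduction M evaluates to its limit;
   and the first inequality shows by induction on fuel, then on M, that approx n
   M is below every D to which M evaluates. *)
Require Import Defs.
From mathcomp Require Import all_boot all_order all_algebra.
From mathcomp Require Import finmap.
From mathcomp Require Import all_classical all_reals all_analysis.
Set Implicit Arguments.
Unset Strict Implicit.
Unset Printing Implicit Defensive.
Import Order.TTheory GRing.Theory Num.Theory.

Local Open Scope classical_set_scope.
Local Open Scope ring_scope.
Local Open Scope ereal_scope.

(** * Nonnegative sums: scaling, a single nonzero term, passage to the limit *)

Lemma esumZl (R : realType) (T : choiceType) (I : set T) (c : R)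
    (f : T -> \bar R) : (0 <= c)%R -> (forall i, 0 <= f i) ->
  \esum_(i in I) (c%:E * f i) = c%:E * \esum_(i in I) f i.
Proof.
rewrite le_eqVlt => /predU1P[<- f0|c0 f0].
  by rewrite mul0e esum1// => i _; rewrite mul0e.
have cV (x : \bar R) : c^-1%:E * (c%:E * x) = x.
  by rewrite muleA -EFinM mulVf ?gt_eqF// mul1e.
apply/eqP; rewrite eq_le; apply/andP; split.
  by apply: esum_mull_le => //; rewrite lee_fin ltW.
(* The converse inequality is [esum_mull_le] again, for the scalar [c^-1] and the family [c * f]. *)
rewrite -lee_pdivlMl//.
have /= := @esum_mull_le R T I c^-1%:E (fun i => c%:E * f i).
under eq_esum do rewrite cV.
apply=> [|i]; first by rewrite lee_fin invr_ge0 ltW.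
by rewrite mule_ge0// lee_fin ltW.
Qed.

Lemma esum_unique (R : realType) (T : choiceType) (t : T) (f : T -> \bar R) :
  0 <= f t -> (forall i, i != t -> f i = 0) -> \esum_(i in [set: T]) f i = f t.
Proof.
move=> ft0 f0; rewrite -(esum_set1 ft0) [RHS]esum_mkcond.
apply: eq_esum => i _; case: ifPn => //; rewrite notin_setE/= => /eqP.
exact: f0.
Qed.

(** A bound in the style of Fatou's lemma: limits commute with finite partial sums, and the infinite
    sum is the supremum of these. *)
Lemma esum_lim_le (R : realType) (T : choiceType) (I : set T)
    (f : nat -> T -> \bar R) (l : T -> \bar R) (b : \bar R) :
  (forall n i, 0 <= f n i) -> (forall i, f ^~ i @ \oo --> l i) ->
  (forall n, \esum_(i in I) f n i <= b) -> \esum_(i in I) l i <= b.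
Proof.
move=> f0 fl fb; apply: ge_ereal_sup => /= _ [X [finX XI] <-].
rewrite fsbig_finite//=.
have cvX : (fun n => \sum_(i <- fset_set X) f n i) @ \oo -->
    \sum_(i <- fset_set X) l i.
  by apply: cvg_nnesum => [i _|i _ //]; near=> n; exact: f0.
apply: (cvge_to_le cvX); near=> n.
apply: le_trans (fb n); apply: ereal_sup_ubound; exists X => //.
by rewrite fsbig_finite.
Unshelve. all: by end_near. Qed.

(** * Distributions and sums over pairs of values *)

Lemma distr_ext (R : realType) (D E : distr R) : (forall V, D V = E V) -> D = E.
Proof.
case: D E => [D HD] [E HE] /= DE.
by have {}DE : D = E by [apply/funext]; subst E; congr Distr; exact: Prop_irrelevance.
Qed.

Lemma distr_fin_num (R : realType) (D : distr R) V : D V \is a fin_num.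
Proof.
case: D => D /= [D01 _]; rewrite ge0_fin_numE; have /andP[D0 D1] := D01 V => //.
by rewrite (le_lt_trans D1)// ltry.
Qed.

(** The arguments are plain functions, so that the equation for one reduction step can be rewritten
    under them by [funext]. All pairs are summed: a pair outside the supports has weight zero. *)
Definition bind (R : realType) (d e : value -> \bar R)
    (g : value -> value -> value -> \bar R) (W : value) : \bar R :=
  \esum_(k in [set: value * value]) (d k.1 * e k.2 * g k.1 k.2 W).

Lemma bind_ge0 (R : realType) (d e : value -> \bar R)
    (g : value -> value -> value -> \bar R) W :
  (forall V, 0 <= d V) -> (forall V, 0 <= e V) -> (forall U V W, 0 <= g U V W) ->
  0 <= bind d e g W.
Proof. by move=> d0 e0 g0; apply: esum_ge0 => k _; rewrite !mule_ge0. Qed.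

(** Off the supports of [d'] and [e'] the left-hand term vanishes, so [g] and [g'] are compared on
    the supports only, where the big-step application rule has premises. *)
Lemma le_bind (R : realType) (d d' e e' : value -> \bar R)
    (g g' : value -> value -> value -> \bar R) W :
  (forall V, 0 <= d V) -> (forall V, 0 <= e V) ->
  (forall U V, 0 <= g U V W) -> (forall U V, 0 <= g' U V W) ->
  (forall V, d V <= d' V) -> (forall V, e V <= e' V) ->
  (forall U V, 0 < d' U -> 0 < e' V -> g U V W <= g' U V W) ->
  bind d e g W <= bind d' e' g' W.
Proof.
move=> d0 e0 g0 g'0 dd' ee' gg'; apply: le_esum => -[U V] _ /=.
have d'0 U' : 0 <= d' U' by exact: le_trans (dd' U').
have e'0 U' : 0 <= e' U' by exact: le_trans (ee' U').
have [dU|dU] := ltP 0 (d' U); last first.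
  have -> : d U = 0 by apply/eqP; rewrite eq_le d0 (le_trans (dd' U)).
  by rewrite !mul0e !mule_ge0.
have [eV|eV] := ltP 0 (e' V); last first.
  have -> : e V = 0 by apply/eqP; rewrite eq_le e0 (le_trans (ee' V)).
  by rewrite mule0 mul0e !mule_ge0.
by rewrite lee_pmul ?mule_ge0 ?lee_pmul ?gg'.
Qed.

Lemma bind_avgl (R : realType) (n : nat) (s : seq term)
    (d : term -> value -> \bar R) (e : value -> \bar R)
    (g : value -> value -> value -> \bar R) W :
  (forall L V, 0 <= d L V) -> (forall V, 0 <= e V) ->
  (forall U V W, 0 <= g U V W) ->
  bind (fun V => (n%:R^-1)%:E * \sum_(L <- s) d L V) e g W =
  (n%:R^-1)%:E * \sum_(L <- s) bind (d L) e g W.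
Proof.
move=> d0 e0 g0; rewrite /bind -esum_sum; last first.
  by move=> k L _ _; rewrite !mule_ge0.
rewrite -esumZl//; last first.
  by move=> k; apply: sume_ge0 => L _; rewrite !mule_ge0.
apply: eq_esum => k _; rewrite -!muleA; congr (_ * _).
by rewrite ge0_sume_distrl //; under [RHS]eq_bigr do rewrite -muleA.
Qed.

Lemma bind_avgr (R : realType) (n : nat) (s : seq term)
    (d : value -> \bar R) (e : term -> value -> \bar R)
    (g : value -> value -> value -> \bar R) W :
  (forall V, 0 <= d V) -> (forall L V, 0 <= e L V) ->
  (forall U V W, 0 <= g U V W) ->
  bind d (fun V => (n%:R^-1)%:E * \sum_(L <- s) e L V) g W =
  (n%:R^-1)%:E * \sum_(L <- s) bind d (e L) g W.
Proof.
move=> d0 e0 g0; rewrite /bind -esum_sum; last first.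
  by move=> k L _ _; rewrite !mule_ge0.
rewrite -esumZl//; last first.
  by move=> k; apply: sume_ge0 => L _; rewrite !mule_ge0.
apply: eq_esum => k _; rewrite muleCA -!muleA; congr (_ * _).
rewrite ge0_sume_distrl//.
rewrite ge0_sume_distrr; last by move=> L _; rewrite mule_ge0.
by under [LHS]eq_bigr do rewrite muleA.
Qed.

Lemma bind_dirac (R : realType) (U V : value)
    (g : value -> value -> value -> \bar R) W :
  (forall U V W, 0 <= g U V W) ->
  bind (dirac_value R U) (dirac_value R V) g W = g U V W.
Proof.
move=> g0; rewrite /bind (@esum_unique _ _ (U, V))/= ?eqxx ?mul1e//.
move=> [U' V'] /=; rewrite xpair_eqE; case: (U' == U) => /=; last by rewrite !mul0e.
by move=> /negbTE ->; rewrite mule0 mul0e.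
Qed.

(** The sum over [(P, V)] is reindexed along the injection to [(vlam P, V)]. The remaining pairs
    have a variable in function position and contribute zero. *)
Lemma distr_appE (R : realType) (D E : distr R) (F : term -> value -> distr R)
    (g : value -> value -> value -> \bar R) W :
  (forall U V W, 0 <= g U V W) ->
  (forall P V, distr_support D (vlam P) -> distr_support E V ->
     g (vlam P) V W = F P V W) ->
  (forall n H V, g (@Value (Var n) H) V W = 0) ->
  distr_app D E F W = bind D E g W.
Proof.
move=> g0 gF gV; rewrite /bind /=.
pose q (k : term * value) := (vlam k.1, k.2).
have q_inj : injective q by move=> [P V] [P' V'] [-> ->].
rewrite (esumID (range q)); last by move=> k _; rewrite !mule_ge0 ?distr_ge0.
rewrite [X in _ + X]esum1 ?adde0; last first.
  move=> -[[[n|P|M N|M N] HU] V] //= [_]; first by rewrite gV mule0.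
  by case; exists (P, V) => //; congr (_, _); exact: val_inj.
rewrite setTI esum_image; last by move=> k k' _ _; exact: q_inj.
rewrite [LHS]esum_mkcond; apply: eq_esum => -[P V] _ /=; case: ifPn.
  by rewrite inE/= => -[DP EV]; rewrite gF.
rewrite notin_setE/= => /not_andP[] /negP; rewrite -leNgt => h.
  have -> : D (vlam P) = 0 by apply/eqP; rewrite eq_le h distr_ge0.
  by rewrite !mul0e.
have -> : E V = 0 by apply/eqP; rewrite eq_le h distr_ge0.
by rewrite mule0 mul0e.
Qed.

(** Expanding [D W] as the sum over [U] of [D U * dirac_value R U W], and [mass E] as the sum of the
    [E V], turns each half of the choice into a sum over pairs; the other half is symmetric. *)
Lemma distr_choiceE (R : realType) (D E : distr R)
    (g : value -> value -> value -> \bar R) W :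
  (forall U V, g U V W =
     2^-1%:E * (dirac_value R U W + dirac_value R V W)) ->
  distr_choice D E W = bind D E g W.
Proof.
move=> gE /=; rewrite /bind.
transitivity (\esum_(k in [set: value * value])
  (2^-1%:E * (D k.1 * dirac_value R k.1 W * E k.2) +
   2^-1%:E * (E k.2 * dirac_value R k.2 W * D k.1))); last first.
  apply: eq_esum => -[U V] _ /=; rewrite gE.
  rewrite -ge0_muleDr ?mule_ge0 ?distr_ge0// ?lee_fin//.
  rewrite [RHS]muleCA; congr (_ * _).
  rewrite ge0_muleDr ?lee_fin//; congr (_ + _); first by rewrite muleAC.
  by rewrite muleC muleA.
have half0 : (0 <= 2^-1 :> R)%R by [].
rewrite esumD; try by move=> k _; rewrite !mule_ge0 ?distr_ge0 ?lee_fin.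
rewrite !esumZl//; try by move=> k; rewrite !mule_ge0 ?distr_ge0 ?lee_fin.
have key (A B : distr R) : \esum_(U in [set: value]) \esum_(V in [set: value])
    (A U * dirac_value R U W * B V) = A W * mass B.
  rewrite (@esum_unique _ _ W); first last.
  - move=> U UW; rewrite esum1// => V _ /=.
    by rewrite eq_sym (negbTE UW) mule0 mul0e.
  - by apply: esum_ge0 => V _; rewrite !mule_ge0 ?distr_ge0.
  (* [esumZl] takes a real scalar, hence the appeal to the finiteness of [A W]. *)
  rewrite /= eqxx mule1 /mass.
  have := distr_fin_num A W; have := distr_ge0 A W; case: (A W) => // r r0 _.
  by rewrite esumZl// => V; exact: distr_ge0.
congr (_ * _ + _ * _).
  rewrite -key esum_esum; last by move=> U V _ _; rewrite !mule_ge0 ?distr_ge0.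
  by congr esum; apply/seteqP; split.
rewrite -key exchange_esum; last by move=> U V; rewrite !mule_ge0 ?distr_ge0.
rewrite esum_esum; last by move=> U V _ _; rewrite !mule_ge0 ?distr_ge0.
by congr esum; apply/seteqP; split.
Qed.

(** * Reduction as a function, and approximants indexed by fuel *)

Definition binop (b : bool) : term -> term -> term := if b then Oplus else App.

(** Reduction is deterministic, and [red] computes its only possible result. The empty list stands
    for irreducible terms; this is unambiguous since no rule yields an empty sequence. *)
Fixpoint red (M : term) : seq term :=
  match M with
  | App M N =>
      if is_value M then
        if is_value N then (if M is Lam P then [:: subst0 P N] else [::])
        else [seq App M L | L <- red N]
      else [seq App L N | L <- red M]
  | Oplus M N =>
      if is_value M then
        if is_value N then [:: M; N] else [seq Oplus M L | L <- red N]
      else [seq Oplus L N | L <- red M]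
  | _ => [::]
  end.

Lemma red_binopl b M N : ~~ is_value M ->
  red (binop b M N) = [seq binop b L N | L <- red M].
Proof. by case: b => /= /negbTE ->. Qed.

Lemma red_binopr b M N : is_value M -> ~~ is_value N ->
  red (binop b M N) = [seq binop b M L | L <- red N].
Proof. by case: b => /= -> /negbTE ->. Qed.

Lemma is_value_binop b M N : is_value (binop b M N) = false.
Proof. by case: b. Qed.

Lemma cbv_redE M Ns : cbv_red M Ns -> ~~ is_value M /\ Ns = red M.
Proof.
elim=> {M Ns} [P [V HV]|[V HV] [W HW]|M N Ls _ [/negbTE HM ->]|
  [V HV] M Ls _ [/negbTE HM ->]|M N Ls _ [/negbTE HM ->]|
  [V HV] M Ls _ [/negbTE HM ->]] //=.
all: by rewrite ?HV ?HW ?HM.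
Qed.

Lemma red_cbv M : red M != [::] -> cbv_red M (red M).
Proof.
have map_nil (f : term -> term) s : [seq f x | x <- s] != [::] -> s != [::].
  by case: s.
elim: M => [n|P _|M IHM N IHN|M IHM N IHN] //=.
- case: ifPn => [HM|_ /map_nil/IHM]; last exact: red_appl.
  case: ifPn => [HN|_ /map_nil/IHN]; last exact: (red_appr (Value HM)).
  by case: M HM {IHM} => // P _ _; exact: (red_beta P (Value HN)).
- case: ifPn => [HM|_ /map_nil/IHM]; last exact: red_choicel.
  case: ifPn => [HN _|_ /map_nil/IHN]; last exact: (red_choicer (Value HM)).
  exact: (red_choice (Value HM) (Value HN)).
Qed.

(** [insub] both tests whether [M] is a value and builds it. A stuck term has no successor, so its
    average is an empty sum, that is zero. *)
Fixpoint approx (R : realType) (n : nat) (M : term) : distr R :=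
  if n is n'.+1 then
    if insub M is Some V then dirac_value R V
    else distr_avg (fun i : 'I_(size (red M)) =>
           approx R n' (tnth (in_tuple (red M)) i))
  else distr0 R.

Lemma approx_value (R : realType) n (V : value) :
  approx R n.+1 V = dirac_value R V.
Proof. by rewrite /= valK. Qed.

Lemma approxS (R : realType) n M W : ~~ is_value M ->
  approx R n.+1 M W =
  ((size (red M))%:R^-1)%:E * \sum_(L <- red M) approx R n L W.
Proof.
move=> HM; rewrite /= insubN//= -ge0_sume_distrr; last first.
  by move=> i _; exact: distr_ge0.
by rewrite [in RHS]big_tnth.
Qed.

Lemma approx_beta (R : realType) n P (V : value) W :
  approx R n.+1 (App (Lam P) V) W = approx R n (subst0 P V) W.
Proof.
by rewrite approxS//=; case: V => V /= ->; rewrite big_seq1 invr1 mul1e.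
Qed.

Lemma approx_stuck (R : realType) n k (V : value) W :
  approx R n (App (Var k) V) W = 0.
Proof.
case: n => // n; rewrite approxS//=.
by case: V => V /= ->; rewrite big_nil mule0.
Qed.

Lemma le_approx (R : realType) m n M W : (m <= n)%N ->
  approx R m M W <= approx R n M W.
Proof.
elim: m n M => [|m IH] [|n] M //; first by move=> _; exact: distr_ge0.
rewrite ltnS => mn; have [HM|HM] := boolP (is_value M).
  by rewrite -[M]/(val (Value HM)) !approx_value.
rewrite !approxS// lee_wpmul2l ?lee_fin ?invr_ge0//.
by apply: lee_sum => L _; exact: IH.
Qed.

Lemma small_step_approx (R : realType) n M : small_step M (approx R n M).
Proof.
elim: n M => [|n IH] M; first exact: small_empty.
have [HM|HM] := boolP (is_value M).
  by rewrite -[M]/(val (Value HM)) approx_value; exact: small_value.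
(* On a stuck term [small_red] does not apply, but the approximant is zero and [small_empty]
   does. *)
have [M0|M0] := eqVneq (red M) [::].
  rewrite (_ : approx R n.+1 M = distr0 R); first exact: small_empty.
  by apply: distr_ext => W; rewrite approxS// M0 big_nil mule0.
rewrite /= insubN//; apply: small_red; first exact: red_cbv.
by move=> i; exact: IH.
Qed.

Lemma small_step_le_approx (R : realType) M (D : distr R) :
  small_step M D -> exists n, forall W, D W <= approx R n M W.
Proof.
elim=> {M D} [M|V|M Ns Ds /cbv_redE[HM E] _ IH].
- by exists 0%N.
- by exists 1%N => W; rewrite approx_value.
subst Ns; have [f Hf] := choice IH.
(* There are finitely many premises, so by monotonicity a single fuel serves them all; the extra
   unit pays for the present step. *)
pose m := \max_i f i; exists m.+1 => W.
rewrite approxS// big_tnth ge0_sume_distrr; last first.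
  by move=> i _; exact: distr_ge0.
apply: lee_sum => i _; rewrite lee_wpmul2l ?lee_fin ?invr_ge0//.
by apply: le_trans (Hf i W) _; apply: le_approx; exact: (leq_bigmax i).
Qed.

(** * The two fuel inequalities for compound terms *)

Lemma binop_approx_le (R : realType) b n M N W :
  approx R n (binop b M N) W <=
  bind (approx R n M) (approx R n N)
    (fun U V => approx R n (binop b U V)) W.
Proof.
elim: n M N => [|n IH] M N.
  by apply: bind_ge0 => *; exact: distr_ge0.
have [HM|HM] := boolP (is_value M); last first.
  rewrite approxS ?is_value_binop// red_binopl// big_map size_map.
  (* Only the reducing operand spends a unit of fuel; the two other fuels are lowered to [n] by
     monotonicity, to match the induction hypothesis. *)
  apply: (@le_trans _ _ (bind (approx R n.+1 M) (approx R n N)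
     (fun U V => approx R n (binop b U V)) W)); last first.
    by apply: le_bind => *; rewrite ?distr_ge0 ?le_approx.
  rewrite (funext (fun V => approxS R n V HM)).
  rewrite bind_avgl; try by move=> *; exact: distr_ge0.
  by rewrite lee_wpmul2l ?lee_fin ?invr_ge0// lee_sum.
have [HN|HN] := boolP (is_value N); last first.
  rewrite approxS ?is_value_binop// red_binopr// big_map size_map.
  apply: (@le_trans _ _ (bind (approx R n M) (approx R n.+1 N)
     (fun U V => approx R n (binop b U V)) W)); last first.
    by apply: le_bind => *; rewrite ?distr_ge0 ?le_approx.
  rewrite (funext (fun V => approxS R n V HN)).
  rewrite bind_avgr; try by move=> *; exact: distr_ge0.
  by rewrite lee_wpmul2l ?lee_fin ?invr_ge0// lee_sum.
rewrite -[M]/(val (Value HM)) -[N]/(val (Value HN)) !approx_value.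
by rewrite bind_dirac// => *; exact: distr_ge0.
Qed.

(** Fuels add up because the compound term reduces [M], then [N], then the two resulting values;
    fuel left over by an early value is harmless by monotonicity. *)
Lemma bind_approx_le (R : realType) b m n p M N W :
  bind (approx R m M) (approx R n N) (fun U V => approx R p (binop b U V)) W <=
  approx R (m + n + p) (binop b M N) W.
Proof.
elim: m M N => [|m IHm] M N.
  rewrite /bind esum1 ?distr_ge0// => k _.
  by rewrite !mul0e.
have [HM|HM] := boolP (is_value M); last first.
  rewrite (funext (fun V => approxS R m V HM)).
  rewrite bind_avgl; try by move=> *; exact: distr_ge0.
  rewrite !addSn approxS ?is_value_binop// red_binopl// big_map size_map.
  by rewrite lee_wpmul2l ?lee_fin ?invr_ge0// lee_sum.
rewrite -[M]/(val (Value HM)) approx_value -(approx_value R 0).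
(* With a value on the left, only [N] reduces and its fuel is the one that decreases. *)
elim: n N {IHm} => [|n IHn] N.
  rewrite /bind esum1 ?distr_ge0// => k _.
  by rewrite mule0 mul0e.
have [HN|HN] := boolP (is_value N); last first.
  rewrite (funext (fun V => approxS R n V HN)).
  rewrite bind_avgr; try by move=> *; exact: distr_ge0.
  rewrite addnS [(_ + p)%N]addSn approxS ?is_value_binop// red_binopr//.
  rewrite big_map size_map.
  by rewrite lee_wpmul2l ?lee_fin ?invr_ge0// lee_sum.
rewrite -[N]/(val (Value HN)) !approx_value bind_dirac.
  by apply: le_approx; rewrite leq_addl.
by move=> *; exact: distr_ge0.
Qed.

(** * Limits of the approximants and their equations *)

Definition limit (R : realType) (M : term) (W : value) : \bar R :=
  ereal_sup (range (fun n => approx R n M W)).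

Lemma approx_cvg (R : realType) M W :
  (fun n => approx R n M W) @ \oo --> limit R M W.
Proof.
by apply: ereal_nondecreasing_cvgn => m n mn; exact: le_approx.
Qed.

Lemma limitP (R : realType) M : is_distr (limit R M).
Proof.
apply: is_distr_mass => [W|].
  by apply: (ereal_sup_ge (x := 0)); exists (approx R 0 M W) => //; exists 0%N.
apply: (@esum_lim_le _ _ _ (approx R ^~ M)) => [n V|V|n].
- exact: distr_ge0.
- exact: approx_cvg.
- exact: mass_le1.
Qed.

Definition limitd (R : realType) (M : term) : distr R := Distr (limitP R M).

Lemma approx_le_limit (R : realType) n M W : approx R n M W <= limitd R M W.
Proof. by apply: ereal_sup_ubound; exists n. Qed.

Lemma limit_le (R : realType) M W x :
  (forall n, approx R n M W <= x) -> limitd R M W <= x.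
Proof. by move=> h; apply: ge_ereal_sup => _ [n _ <-]. Qed.

(** Each fuel inequality gives one direction. For the second, the three fuels are all [n]: the terms
    of the sum converge to those of the limit, while the sums stay below the approximant of fuel
    [n + n + n]. *)
Lemma limit_binop (R : realType) b M N W :
  limitd R (binop b M N) W =
  bind (limitd R M) (limitd R N) (fun U V => limitd R (binop b U V)) W.
Proof.
apply/eqP; rewrite eq_le; apply/andP; split.
  apply: limit_le => n; apply: le_trans (binop_approx_le _ _ _ _ _ _) _.
  by apply: le_bind => *; rewrite ?distr_ge0 ?approx_le_limit.
apply: (@esum_lim_le _ _ _ (fun n k => approx R n M k.1 * approx R n N k.2 *
   approx R n (binop b k.1 k.2) W)) => [n k|k|n].
- by rewrite !mule_ge0 ?distr_ge0.
(* Finiteness rules out the indeterminate products of zero and infinity, so the limit of a product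
   is the product of the limits. *)
- have fin_limit M' V : limit R M' V \is a fin_num.
    exact: (distr_fin_num (limitd R M')).
  have MN : (fun n => approx R n M k.1 * approx R n N k.2) @ \oo -->
      limit R M k.1 * limit R N k.2.
    by apply: cvgeM; rewrite ?mule_def_fin//; exact: approx_cvg.
  by apply: (cvgeM _ MN (@approx_cvg R (binop b k.1 k.2) W));
    rewrite mule_def_fin ?fin_numM.
- apply: le_trans (bind_approx_le R b n n n M N W) _.
  exact: approx_le_limit.
Qed.

(** Dropping the approximant of fuel zero leaves the limit unchanged, so one reduction step can be
    unfolded before the limit is taken. *)
Lemma limit_shift (R : realType) M W (f : nat -> \bar R) l :
  (forall n, approx R n.+1 M W = f n) -> f @ \oo --> l -> limitd R M W = l.
Proof.
move=> Mf; have <- : [sequence approx R n.+1 M W]_n = f by exact/funext.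
rewrite (cvg_shiftS (fun n => approx R n M W)).
exact: cvg_unique (@approx_cvg _ M W).
Qed.

Lemma limit_value (R : realType) (V : value) : limitd R V = dirac_value R V.
Proof.
apply: distr_ext => W; apply: limit_shift => [n|]; first by rewrite approx_value.
exact: cvg_cst.
Qed.

Lemma limit_beta (R : realType) P (V : value) W :
  limitd R (App (Lam P) V) W = limitd R (subst0 P V) W.
Proof.
by apply: limit_shift (@approx_cvg _ _ _) => n; exact: approx_beta.
Qed.

Lemma limit_stuck (R : realType) k (V : value) W :
  limitd R (App (Var k) V) W = 0.
Proof.
by apply: limit_shift (cvg_cst 0) => n; exact: approx_stuck.
Qed.

Lemma limit_choice (R : realType) (U V : value) W :
  limitd R (Oplus U V) W = 2^-1%:E * (dirac_value R U W + dirac_value R V W).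
Proof.
rewrite -!limit_value; apply: limit_shift (_ : (fun n => 2^-1%:E *
  (approx R n U W + approx R n V W)) @ \oo --> _) => [n|].
  rewrite approxS//=; case: U V => [U HU] [V HV] /=; rewrite HU HV /=.
  by rewrite !big_cons big_nil adde0.
apply: cvgeZl => //; apply: cvgeD; try exact: approx_cvg.
by rewrite fin_num_adde_defr// distr_fin_num.
Qed.

(** * Limits against the coinductive big-step rules *)

Lemma distr_app_limit (R : realType) M N :
  distr_app (limitd R M) (limitd R N) (fun P V => limitd R (subst0 P V)) =
  limitd R (App M N).
Proof.
apply: distr_ext => W; rewrite (limit_binop R false).
(* On abstractions this [g] agrees with the premises by beta; on variables the application is stuck
   and its limit is zero. *)
rewrite (@distr_appE _ _ _ _ (fun U V => limitd R (App U V)))// => *.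
- exact: distr_ge0.
- by rewrite limit_beta.
- by rewrite limit_stuck.
Qed.

Lemma distr_choice_limit (R : realType) M N :
  distr_choice (limitd R M) (limitd R N) = limitd R (Oplus M N).
Proof.
apply: distr_ext => W; rewrite (limit_binop R true).
rewrite (@distr_choiceE _ _ _ (fun U V => limitd R (Oplus U V)))// => *.
exact: limit_choice.
Qed.

(* [case: _ /] rather than [rewrite]: an application of [eq_ind_r] above the
   corecursive calls would break the guard condition. *)
Lemma big_step_limit (R : realType) M : big_step M (limitd R M).
Proof.
move: M; cofix CH => -[n|P|M N|M N].
- case: _ / (esym (limit_value R (@Value (Var n) isT))).
  exact: (big_value _ (@Value (Var n) isT)).
- by case: _ / (esym (limit_value R (vlam P))); exact: (big_value _ (vlam P)).
- by case: _ / (distr_app_limit R M N); apply: big_app => *; exact: CH.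
- by case: _ / (distr_choice_limit R M N); apply: big_choice; exact: CH.
Qed.

Lemma big_step_valueE (R : realType) (V : value) (D : distr R) :
  big_step V D -> D = dirac_value R V.
Proof.
case: V => V HV /= VD; case: VD HV => [[V' HV'] /= HV|//|//].
by congr dirac_value; exact: val_inj.
Qed.

(** A coinductive derivation offers no induction, so fuel and term structure do: operands keep the
    fuel [n.+1] but are smaller terms, while the body of a beta step may grow but has fuel [n]
    only. *)
Lemma approx_le_big_step (R : realType) n M (D : distr R) W :
  big_step M D -> approx R n M W <= D W.
Proof.
elim: n M D W => [|n IHn] M D W; first by move=> _; exact: distr_ge0.
elim: M D W => [k|P _|M IHM N IHN|M IHM N IHN] D W MD.
- rewrite -[Var k]/(val (@Value (Var k) isT)) in MD *.
  by rewrite approx_value (big_step_valueE MD).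
- rewrite -[Lam P]/(val (vlam P)) in MD *.
  by rewrite approx_value (big_step_valueE MD).
- move EL: (App M N) MD => L MD.
  case: MD EL => {L D} [[V HV] /= EV|M' N' D E F MD NE HF [? ?]|//]; subst => //.
  apply: le_trans (binop_approx_le R false _ _ _ _) _.
  (* [F] is extended by zero to variables in function position. *)
  pose g (U V : value) : value -> \bar R :=
    if val U is Lam P then F P V else fun=> 0.
  have g0 U V W' : 0 <= g U V W'.
    by rewrite /g; case: (val U) => // P; exact: distr_ge0.
  rewrite (@distr_appE _ _ _ _ g)//.
  apply: le_bind => [V|V|U V|U V|V|V|U V DU EV]; rewrite ?distr_ge0 ?IHM ?IHN//.
  case: U DU => -[k|P|//|//] HU DU; first by rewrite approx_stuck.
  rewrite approx_beta /g /=; apply/IHn/HF => //.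
  by rewrite (_ : vlam P = Value HU)//; exact: val_inj.
- move EL: (Oplus M N) MD => L MD.
  case: MD EL => {L D} [[V HV] /= EV|//|M' N' D E MD NE [? ?]]; subst => //.
  apply: le_trans (binop_approx_le R true _ _ _ _) _.
  (* A choice between two values has a known limit, which bounds each of its approximants. *)
  rewrite (@distr_choiceE _ _ _ (fun U V => limitd R (Oplus U V))); last first.
    by move=> U V; exact: limit_choice.
  by apply: le_bind => *; rewrite ?distr_ge0 ?approx_le_limit ?IHM ?IHN.
Qed.

(** * Both semantics coincide with the limit *)

Lemma S_IV_limit (R : realType) M : S_IV R M = limit R M.
Proof.
apply/funext => W; apply/eqP; rewrite eq_le; apply/andP; split.
  (* The approximants are cofinal among the small-step distributions of [M]. *)
  apply: ge_ereal_sup => _ [D /small_step_le_approx[n Dn] <-].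
  by apply: le_trans (Dn W) _; exact: approx_le_limit.
apply: limit_le => n; apply: ereal_sup_ubound.
by exists (approx R n M) => //; exact: small_step_approx.
Qed.

(** The infimum is attained: the limit is itself a big-step distribution of [M] and lies below all
    the others. *)
Lemma B_CV_limit (R : realType) M : B_CV R M = limit R M.
Proof.
apply/funext => W; apply/eqP; rewrite eq_le; apply/andP; split.
  by apply: ereal_inf_lbound; exists (limitd R M) => //; exact: big_step_limit.
apply: le_ereal_inf_tmp => _ [D MD <-].
by apply: limit_le => n; exact: approx_le_big_step.
Qed.

Theorem theorem2 (R : realType) (M : term) (hM : closed_term M) :
  B_CV R M = S_IV R M /\ is_distr (S_IV R M).
Proof. by rewrite B_CV_limit S_IV_limit; split => //; exact: limitP. Qed.
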